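(* Let $(x_k)$ be an infinite sequence generated by the HSLM algorithm (described in the context), with $g_k\neq0$ for all $k$. Let $P_k:=V_kV_k^\top$, $H_k:=J_k^\top J_k$, $R_k:=\mu_kD_{k,p}$, $S_k:=S(x_k)$ and $\gamma_k:=\|(I-P_k)g_k\|/\|g_k\|$. Assume: (1) There exist $m_B,M_B$ such that $0<m_B\le\lambda_{\min}(B_k)\le\lambda_{\max}(B_k)\le M_B<\infty$ for all $k$. (2) There is a strict local minimizer $x^\star$ of $F$ with $\nabla F(x^\star)=0$ and $\nabla^2F(x^\star)\succ0$, and there are a neighborhood $U$ of $x^\star$ and $L_2>0$ such that $\|\nabla^2F(x)-\nabla^2F(y)\|\le L_2\|x-y\|$ for all $x,y\in U$. (3) $x_k\to x^\star$, $\gamma_k\to0$, $\mu_k\to0$, and there exists a sequence $\varepsilon_k\to0$ of nonnegative numbers such that $\|H_kP_k-P_kH_kP_k\|\le\varepsilon_k\|H_k\|$ for all $k$. (4) There exists $c>0$ such that $\|S(x)\|\le c\|x-x^\star\|$ for all $x$ close enough to $x^\star$. (5) $t_k=1$ for all sufficiently large $k$. Let $e_k:=x_k-x^\star$. Then there is a constant $C>0$, independent of $k$, such that with $\theta_k:=C(\gamma_k+\varepsilon_k+\|R_k\|+\|S_k\|)$ the following hold: (i) If there is $\bar\theta<1$ with $\theta_k\le\bar\theta$ for all sufficiently large $k$, then there is $q<1$ such that $\|e_{k+1}\|\le q\|e_k\|$ for all sufficiently large $k$ (linear convergence). (ii) If $\theta_k\to0$, then $\|e_{k+1}\|/\|e_k\|\to0$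 (superlinear convergence).
   Context: Norms are Euclidean (spectral for matrices). $\mathbf r=(\mathbf r_1,\dots,\mathbf r_m):\mathbb R^n\to\mathbb R^m$ is a residual map, continuously differentiable and twice differentiable near the solution considered, with Jacobian $\mathbf J(x)\in\mathbb R^{m\times n}$; $F(x)=\tfrac12\|\mathbf r(x)\|^2$, $\mathbf g(x)=\nabla F(x)=\mathbf J(x)^\top\mathbf r(x)$, and $\nabla^2F(x)=\mathbf J(x)^\top\mathbf J(x)+S(x)$ with $S(x)=\sum_{i=1}^m\mathbf r_i(x)\nabla^2\mathbf r_i(x)$. At an iterate $x_k$ write $r_k=\mathbf r(x_k)$, $J_k=\mathbf J(x_k)$, $g_k=\mathbf g(x_k)$. HSLM algorithm. Fixed parameters: $\mu_0>0$, $\delta>0$, $\eta_{\min}\in(0,1]$, $\alpha,\beta\in(0,1)$, thresholds $\rho_{\mathrm{low}}\le\rho_{\mathrm{high}}$, factors $\mu_{up},\mu_{down}>1$. Iteration $k$ (with $g_k\ne0$) is as follows. - A matrix $V_k\in\mathbb R^{n\times p}$ with orthonormal columns is constructed ($p$ may depend on $k$) from candidate directions, and the subspace is enlarged until $\|V_k^\top g_k\|^2/\|g_k\|^2\ge\eta_{\min}$. For the analysis, $V_k$ can be any matrix with orthonormal columns having the stated properties. - Let $J_{k,p}=J_kV_k=U_k\Sigma_{k,p}Z_k^\top$ be a (thin) singular value decomposition: $U_k\in\mathbb R^{m\times p}$ has orthonormal columns, $\Sigma_{k,p}=\mathrm{diag}(\sigma_{k,1},\dots,\sigma_{k,p})$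 with $\sigma_{k,i}\ge0$, and $Z_k\in\mathbb R^{p\times p}$ is orthogonal. - Let $D_{k,p}=\mathrm{diag}(d_{k,1},\dots,d_{k,p})$ with $d_{k,i}=\max(\sigma_{k,i}^2,\delta)$, and $B_k=\Sigma_{k,p}^2+\mu_kD_{k,p}$. - Let $y_k$ solve $B_ky_k=-\Sigma_{k,p}U_k^\top r_k$ and set $s_k=V_kZ_ky_k$. - (Armijo backtracking) Let $t_k=\beta^{j_k}$, where $j_k\ge0$ is the smallest nonnegative integer such that $F(x_k+t_ks_k)\le F(x_k)+\alpha t_k g_k^\top s_k$; set $x_{k+1}=x_k+t_ks_k$. - (Damping update) With $m_k(s)=\tfrac12\|r_k+J_ks\|^2+\tfrac{\mu_k}{2}\|D_{k,p}^{1/2}Z_k^\top V_k^\top s\|^2$ and $\rho_k=\dfrac{F(x_k)-F(x_k+t_ks_k)}{m_k(0)-m_k(t_ks_k)}$, set $\mu_{k+1}=\mu_k/\mu_{down}$ if $\rho_k\ge\rho_{\mathrm{high}}$, $\mu_{k+1}=\mu_k$ if $\rho_{\mathrm{low}}\le\rho_k<\rho_{\mathrm{high}}$, and $\mu_{k+1}=\mu_k\mu_{up}$ if $\rho_k<\rho_{\mathrm{low}}$. In particular $\mu_k>0$ for all $k$. *)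

(* Defs.v *)
(* R^n is represented by column vectors over an arbitrary real field R : realType. *)
From HB Require Import structures.
From mathcomp Require Import all_boot all_order all_algebra.
From mathcomp Require Import all_classical all_reals all_analysis.

Set Implicit Arguments.
Unset Strict Implicit.
Unset Printing Implicit Defensive.

Import Order.TTheory GRing.Theory Num.Theory numFieldNormedType.Exports.

Local Open Scope classical_set_scope.
Local Open Scope ring_scope.

(* The library norm `|A| on matrices is the entrywise maximum. It is used below
   only through the topology (limits, continuity, differentiability), which is
   the Euclidean one; every quantitative statement uses enorm and opnorm. *)

Definition enorm (R : realType) (n : nat) (x : 'cV[R]_n) : R :=
  Num.sqrt (\sum_i x i 0 ^+ 2).

(* Spectral norm: the operator norm induced by the Euclidean norms. *)
Definition opnorm (R : realType) (m n : nat) (A : 'M[R]_(m, n)) : R :=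
  sup [set enorm (A *m x) | x in [set x : 'cV[R]_n | enorm x <= 1]].

(* Extreme real eigenvalues; meaningful only for symmetric matrices of
   positive size (otherwise the set of eigenvalues may be empty). *)
Definition lambda_min (R : realType) (n : nat) (A : 'M[R]_n) : R :=
  inf [set a | eigenvalue A a].

Definition lambda_max (R : realType) (n : nat) (A : 'M[R]_n) : R :=
  sup [set a | eigenvalue A a].

Definition posdef (R : realType) (n : nat) (A : 'M[R]_n) : Prop :=
  forall v : 'cV[R]_n, v != 0 -> 0 < (v^T *m A *m v) 0 0.

Section Calculus.
Context {R : realType} {m n : nat}.

(* The library's jacobian is for row vectors and is transposed with respect to
   the usual m x n convention followed here. *)
Definition jac (f : 'cV[R]_n -> 'cV[R]_m) (x : 'cV[R]_n) : 'M[R]_(m, n) :=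
  \matrix_(i, j) 'D_(delta_mx j 0) (fun y => f y i 0) x.

Definition grad (f : 'cV[R]_n -> R) (x : 'cV[R]_n) : 'cV[R]_n :=
  \col_j 'D_(delta_mx j 0) f x.

End Calculus.

Definition hess (R : realType) (n : nat) (f : 'cV[R]_n -> R) (x : 'cV[R]_n) :
  'M[R]_n := jac (grad f) x.

Definition strict_local_min (R : realType) (n : nat) (f : 'cV[R]_n -> R)
    (a : 'cV[R]_n) : Prop :=
  \forall x \near a, x != a -> f a < f x.

Section LeastSquares.
Context {R : realType} {m n : nat}.
Variable r : 'cV[R]_n -> 'cV[R]_m.

Definition cont_differentiable : Prop :=
  (forall x, differentiable r x) /\ continuous (jac r).

Definition twice_differentiable_near (a : 'cV[R]_n) : Prop :=
  \forall x \near a, differentiable r x /\ differentiable (jac r) x.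

Definition objective (x : 'cV[R]_n) : R := 2^-1 * enorm (r x) ^+ 2.

(* S(x), the second-order part of the Hessian of the objective. *)
Definition curvature (x : 'cV[R]_n) : 'M[R]_n :=
  \sum_i r x i 0 *: hess (fun y => r y i 0) x.

End LeastSquares.

Record hslm_params (R : realType) := HslmParams {
  mu0 : R;
  delta : R;
  eta_min : R;
  alpha : R;
  beta : R;
  rho_low : R;
  rho_high : R;
  mu_up : R;
  mu_down : R }.

Definition admissible (R : realType) (prm : hslm_params R) : Prop :=
  [/\ 0 < mu0 prm, 0 < delta prm & 0 < eta_min prm <= 1] /\
  [/\ 0 < alpha prm < 1, 0 < beta prm < 1, rho_low prm <= rho_high prm,
      1 < mu_up prm & 1 < mu_down prm].

(* All the quantities produced during one iteration; the subspace dimension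
   it_p may change from one iteration to the next. The diagonal of the matrix
   of singular values is the row vector it_sigma. *)
Record hslm_iter (R : realType) (m n : nat) := HslmIter {
  it_x : 'cV[R]_n;
  it_mu : R;
  it_p : nat;
  it_V : 'M[R]_(n, it_p);
  it_U : 'M[R]_(m, it_p);
  it_sigma : 'rV[R]_it_p;
  it_Z : 'M[R]_it_p;
  it_y : 'cV[R]_it_p;
  it_t : R }.

Section HSLM.
Context {R : realType} {m n : nat}.
Variables (prm : hslm_params R) (r : 'cV[R]_n -> 'cV[R]_m).
Implicit Types (b : hslm_iter R m n).

Definition it_J b : 'M[R]_(m, n) := jac r (it_x b).

Definition it_g b : 'cV[R]_n := grad (objective r) (it_x b).

Definition it_Sigma b : 'M[R]_(it_p b) := diag_mx (it_sigma b).

Definition it_d b : 'rV[R]_(it_p b) :=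
  \row_i Num.max (it_sigma b 0 i ^+ 2) (delta prm).

Definition it_D b : 'M[R]_(it_p b) := diag_mx (it_d b).

Definition it_sqrtD b : 'M[R]_(it_p b) := diag_mx (map_mx Num.sqrt (it_d b)).

Definition it_R b : 'M[R]_(it_p b) := it_mu b *: it_D b.

Definition it_B b : 'M[R]_(it_p b) := it_Sigma b *m it_Sigma b + it_R b.

Definition it_s b : 'cV[R]_n := it_V b *m it_Z b *m it_y b.

Definition it_P b : 'M[R]_n := it_V b *m (it_V b)^T.

Definition it_H b : 'M[R]_n := (it_J b)^T *m it_J b.

Definition it_S b : 'M[R]_n := curvature r (it_x b).

Definition it_gamma b : R :=
  enorm ((1%:M - it_P b) *m it_g b) / enorm (it_g b).

Definition it_next b : 'cV[R]_n := it_x b + it_t b *: it_s b.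

Definition armijo b (t : R) : Prop :=
  objective r (it_x b + t *: it_s b) <=
  objective r (it_x b) + alpha prm * t * ((it_g b)^T *m it_s b) 0 0.

Definition armijo_step b : Prop :=
  exists j : nat,
    [/\ it_t b = beta prm ^+ j,
        armijo b (beta prm ^+ j) &
        forall i : nat, (i < j)%N -> ~ armijo b (beta prm ^+ i)].

Definition it_model b (s : 'cV[R]_n) : R :=
  2^-1 * enorm (r (it_x b) + it_J b *m s) ^+ 2 +
  it_mu b / 2 * enorm (it_sqrtD b *m (it_Z b)^T *m (it_V b)^T *m s) ^+ 2.

Definition it_rho b : R :=
  (objective r (it_x b) - objective r (it_next b)) /
  (it_model b 0 - it_model b (it_t b *: it_s b)).

Definition it_mu_next b : R :=
  if rho_high prm <= it_rho b then it_mu b / mu_down prm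
  else if rho_low prm <= it_rho b then it_mu b
  else it_mu b * mu_up prm.

Definition hslm_iteration b : Prop :=
  [/\ (it_V b)^T *m it_V b = 1%:M,
      enorm ((it_V b)^T *m it_g b) ^+ 2 / enorm (it_g b) ^+ 2 >= eta_min prm
    & [/\ it_J b *m it_V b = it_U b *m it_Sigma b *m (it_Z b)^T,
          (it_U b)^T *m it_U b = 1%:M,
          (it_Z b)^T *m it_Z b = 1%:M
        & forall i, 0 <= it_sigma b 0 i]] /\
  [/\ it_B b *m it_y b = - (it_Sigma b *m (it_U b)^T *m r (it_x b))
    & armijo_step b].

Definition hslm_sequence (it : nat -> hslm_iter R m n) : Prop :=
  it_mu (it 0%N) = mu0 prm /\
  forall k : nat,
    [/\ it_g (it k) != 0,
        hslm_iteration (it k),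
        it_x (it k.+1) = it_next (it k)
      & it_mu (it k.+1) = it_mu_next (it k)].

End HSLM.

(* Main.v *)
Require Import Defs.
From mathcomp Require Import all_boot all_order all_algebra.
From mathcomp Require Import all_classical all_reals all_analysis.
From mathcomp Require Import ring lra.

(* Write e = x_k - x*, A = hess F(x* ), g = g_k and s = s_k. Assumption (4) gives
   S(x* ) = 0, hence A = J*^T J* is the limit of H_k. A full step satisfies
     A (e + s) = (A e - g) + (A - H_k) s + (I - P_k) g
                 + (H_k P_k - P_k H_k P_k) s - V_k Z_k R_k y_k.
   Here |(I - P_k) g| = gamma_k |g| with |g| = O(|e|), A e - g = o(|e|), and the
   three terms linear in s have coefficients tending to 0, the last one because
   |R_k y_k| <= mu_k (delta + |H_k|) |s|. Since |s| <= |e| + |e + s| and A is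
   invertible, |e + s| = o(|e|). Under (3) and (4), theta_k already tends to 0 for
   every C, so this superlinear rate yields both conclusions. *)

Set Implicit Arguments.
Unset Strict Implicit.
Unset Printing Implicit Defensive.
Import Order.TTheory GRing.Theory Num.Theory numFieldNormedType.Exports.
Local Open Scope classical_set_scope.
Local Open Scope ring_scope.

(** * Euclidean and spectral norms *)

Section EuclideanNorm.
Context {R : realType}.

Lemma enorm_ge0 n (v : 'cV[R]_n) : 0 <= enorm v.
Proof. exact: sqrtr_ge0. Qed.

Lemma sqr_enorm_sum n (v : 'cV[R]_n) : enorm v ^+ 2 = \sum_i v i 0 ^+ 2.
Proof. by rewrite sqr_sqrtr // sumr_ge0 // => i _; rewrite sqr_ge0. Qed.

Lemma sqr_enorm n (v : 'cV[R]_n) : enorm v ^+ 2 = (v^T *m v) 0 0.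
Proof.
by rewrite sqr_enorm_sum mxE; apply: eq_bigr => i _; rewrite mxE expr2.
Qed.

Lemma enorm_le n (v : 'cV[R]_n) a : 0 <= a -> enorm v ^+ 2 <= a ^+ 2 ->
  enorm v <= a.
Proof. by move=> a0; rewrite ler_pXn2r // nnegrE enorm_ge0. Qed.

Lemma coord_le_enorm n (v : 'cV[R]_n) i : `|v i 0| <= enorm v.
Proof.
rewrite -(@ler_pXn2r _ 2) ?nnegrE ?enorm_ge0 // real_normK ?num_real //.
rewrite sqr_enorm_sum (bigD1 i) //= lerDl sumr_ge0 // => j _.
exact: sqr_ge0.
Qed.

Lemma enorm0 n : enorm (0 : 'cV[R]_n) = 0.
Proof. by rewrite /enorm big1 ?sqrtr0 // => i _; rewrite mxE expr0n. Qed.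

Lemma enorm_eq0 n (v : 'cV[R]_n) : enorm v = 0 -> v = 0.
Proof.
move=> v0; apply/matrixP => i j; rewrite ord1 mxE; apply/eqP.
by rewrite -normr_le0 -v0 coord_le_enorm.
Qed.

Lemma enorm_gt0 n (v : 'cV[R]_n) : v != 0 -> 0 < enorm v.
Proof.
by move=> v0; rewrite lt0r enorm_ge0 andbT; apply: contra v0 => /eqP/enorm_eq0->.
Qed.

Lemma enormN n (v : 'cV[R]_n) : enorm (- v) = enorm v.
Proof. by congr Num.sqrt; apply: eq_bigr => i _; rewrite mxE sqrrN. Qed.

Lemma enormZ n (v : 'cV[R]_n) a : 0 <= a -> enorm (a *: v) = a * enorm v.
Proof.
move=> a0; apply/eqP; rewrite -(@eqrXn2 _ 2) ?mulr_ge0 ?enorm_ge0 //.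
rewrite exprMn !sqr_enorm_sum mulr_sumr.
by apply/eqP/eq_bigr => i _; rewrite mxE exprMn.
Qed.

(** Cauchy-Schwarz: with [a] and [b] the norms of [u] and [v], the squared norm of [b u - a v] is
    nonnegative and equals [2ab (ab - u.v)]. Division by [2ab] requires both norms to be nonzero, so
    the zero cases come first. *)
Lemma enorm_dot_le n (u v : 'cV[R]_n) :
  \sum_i u i 0 * v i 0 <= enorm u * enorm v.
Proof.
set a := enorm u; set b := enorm v.
have [a0|a0] := eqVneq a 0.
  by rewrite a0 mul0r big1 // => i _; rewrite (enorm_eq0 a0) mxE mul0r.
have [b0|b0] := eqVneq b 0.
  by rewrite b0 mulr0 big1 // => i _; rewrite (enorm_eq0 b0) mxE mulr0.
have ab0 : 0 < a * b by rewrite mulr_gt0 // lt0r ?a0 ?b0 enorm_ge0.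
have : 0 <= \sum_i (b * u i 0 - a * v i 0) ^+ 2.
  by apply: sumr_ge0 => i _; rewrite sqr_ge0.
have -> : \sum_i (b * u i 0 - a * v i 0) ^+ 2 =
    2 * (a * b) * (a * b - \sum_i u i 0 * v i 0).
  transitivity (b ^+ 2 * (\sum_i u i 0 ^+ 2) + a ^+ 2 * (\sum_i v i 0 ^+ 2)
      - 2 * (a * b) * \sum_i u i 0 * v i 0).
    rewrite !mulr_sumr -big_split -sumrB /=; apply: eq_bigr => i _; ring.
  rewrite -!sqr_enorm_sum -/a -/b; ring.
by rewrite pmulr_rge0 ?subr_ge0 // mulr_gt0.
Qed.

Lemma ler_enormD n (u v : 'cV[R]_n) : enorm (u + v) <= enorm u + enorm v.
Proof.
apply: enorm_le; first by rewrite addr_ge0 ?enorm_ge0.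
rewrite sqrrD !sqr_enorm_sum.
have -> : \sum_i (u + v) i 0 ^+ 2 = \sum_i u i 0 ^+ 2 +
    (\sum_i u i 0 * v i 0) *+ 2 + \sum_i v i 0 ^+ 2.
  rewrite -sumrMnl -!big_split /=; apply: eq_bigr => i _.
  by rewrite mxE sqrrD.
by rewrite lerD2r lerD2l lerMn2r enorm_dot_le.
Qed.

Lemma ler_enormB n (u v : 'cV[R]_n) : enorm (u - v) <= enorm u + enorm v.
Proof. by rewrite -(enormN v) ler_enormD. Qed.

Lemma enorm_le_sum n (v : 'cV[R]_n) : enorm v <= \sum_i `|v i 0|.
Proof.
apply: enorm_le; first exact: sumr_ge0.
rewrite sqr_enorm_sum expr2 mulr_suml; apply: ler_sum => i _.
rewrite -real_normK ?num_real // expr2 ler_wpM2l //.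
by rewrite (bigD1 i) //= lerDl sumr_ge0.
Qed.

Lemma enorm_mono n (u v : 'cV[R]_n) :
  (forall i, `|u i 0| <= `|v i 0|) -> enorm u <= enorm v.
Proof.
move=> uv; apply: enorm_le; first exact: enorm_ge0.
rewrite !sqr_enorm_sum; apply: ler_sum => i _.
rewrite -[u i 0 ^+ 2]real_normK -1?[v i 0 ^+ 2]real_normK ?num_real //.
by rewrite ler_pXn2r ?nnegrE.
Qed.

Lemma enorm_isometry n p (V : 'M[R]_(n, p)) (x : 'cV[R]_p) :
  V^T *m V = 1%:M -> enorm (V *m x) = enorm x.
Proof.
move=> V1; apply/eqP; rewrite -(@eqrXn2 _ 2) ?enorm_ge0 // !sqr_enorm.
by rewrite trmx_mul mulmxA -(mulmxA _ _ V) V1 mulmx1.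
Qed.

(* Pythagoras: [|x|^2 = |V^T x|^2 + |x - V V^T x|^2]. *)
Lemma enorm_tr_isometry n p (V : 'M[R]_(n, p)) (x : 'cV[R]_n) :
  V^T *m V = 1%:M -> enorm (V^T *m x) <= enorm x.
Proof.
move=> V1; apply: enorm_le; first exact: enorm_ge0.
have : 0 <= enorm (x - V *m (V^T *m x)) ^+ 2 by rewrite sqr_ge0.
suff -> : enorm (x - V *m (V^T *m x)) ^+ 2 =
    enorm x ^+ 2 - enorm (V^T *m x) ^+ 2 by rewrite subr_ge0.
have sub00 (a b : 'M[R]_1) : a 0 0 - b 0 0 = (a - b) 0 0 by rewrite !mxE.
rewrite !sqr_enorm sub00; congr (fun_of_matrix _ 0 0).
rewrite [(_ - _)^T]linearB /= !trmx_mul !trmxK mulmxBl !mulmxBr -!mulmxA.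
by rewrite (mulmxA V^T V) V1 mul1mx subrr subr0.
Qed.

(** A crude bound with two uses: it makes the set whose supremum is [opnorm] bounded, and it later
    turns entrywise convergence into convergence in [opnorm]. *)
Lemma enorm_mulmx_le_sum m n (A : 'M[R]_(m, n)) (x : 'cV[R]_n) :
  enorm (A *m x) <= (\sum_i \sum_j `|A i j|) * enorm x.
Proof.
apply: le_trans (enorm_le_sum _) _; rewrite mulr_suml; apply: ler_sum => i _.
rewrite mxE mulr_suml; apply: le_trans (ler_norm_sum _ _ _) _.
apply: ler_sum => j _; rewrite normrM ler_wpM2l // coord_le_enorm //.
Qed.

Lemma enorm_mulmx_le_opnorm m n (A : 'M[R]_(m, n)) (x : 'cV[R]_n) :
  enorm x <= 1 -> enorm (A *m x) <= opnorm A.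
Proof.
move=> x1; apply: sup_ubound; last by exists x.
exists (\sum_i \sum_j `|A i j|) => _ [y /= y1 <-].
apply: le_trans (enorm_mulmx_le_sum _ _) _.
by rewrite ler_piMr // sumr_ge0 // => i _; rewrite sumr_ge0.
Qed.

Lemma opnorm_ge0 m n (A : 'M[R]_(m, n)) : 0 <= opnorm A.
Proof.
apply: le_trans (enorm_ge0 (A *m 0)) _.
by apply: enorm_mulmx_le_opnorm; rewrite enorm0.
Qed.

Lemma enorm_mulmx_le m n (A : 'M[R]_(m, n)) (x : 'cV[R]_n) :
  enorm (A *m x) <= opnorm A * enorm x.
Proof.
have [->|x0] := eqVneq x 0; first by rewrite mulmx0 !enorm0 mulr0.
have x1 := enorm_gt0 x0.
(* By homogeneity it suffices to bound [A] on the unit vector [x / |x|]. *)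
rewrite -ler_pdivrMr // mulrC -enormZ ?invr_ge0 ?enorm_ge0 // scalemxAr.
apply: enorm_mulmx_le_opnorm.
by rewrite enormZ ?invr_ge0 ?enorm_ge0 // mulVf ?gt_eqF.
Qed.

Lemma opnorm_le_sum m n (A : 'M[R]_(m, n)) :
  opnorm A <= \sum_i \sum_j `|A i j|.
Proof.
apply: ge_sup.
  by exists (enorm (A *m 0)); exists 0 => //=; rewrite enorm0 ler01.
move=> _ [y /= y1 <-]; apply: le_trans (enorm_mulmx_le_sum _ _) _.
by rewrite ler_piMr // sumr_ge0 // => i _; rewrite sumr_ge0.
Qed.

End EuclideanNorm.

(** * Identities and estimates for a single iteration *)

Section Iteration.
Context {R : realType} {m n : nat}.
Variables (prm : hslm_params R) (r : 'cV[R]_n -> 'cV[R]_m).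
Implicit Types b : hslm_iter R m n.

(* [s = P s], and multiplying the equation for [y] by [V Z] gives
   [P H s + V Z R y = - P g]. *)
Lemma gauss_newton_step_residual b :
  hslm_iteration prm r b -> it_g r b = (it_J r b)^T *m r (it_x b) ->
  it_H r b *m it_s b + it_g r b =
    (1%:M - it_P b) *m it_g r b
    + (it_H r b *m it_P b - it_P b *m it_H r b *m it_P b) *m it_s b
    - it_V b *m it_Z b *m (it_R prm b *m it_y b).
Proof.
move=> [[VV _ [JV UU ZZ _]] [By _]] gE.
have ZZ' : it_Z b *m (it_Z b)^T = 1%:M by apply: mulmx1C.
have JVt : (it_V b)^T *m (it_J r b)^T
    = it_Z b *m it_Sigma b *m (it_U b)^T.
  by rewrite -trmx_mul JV !trmx_mul trmxK tr_diag_mx !mulmxA.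
have Ps : it_P b *m it_s b = it_s b.
  by rewrite /it_P /it_s -!mulmxA (mulmxA (it_V b)^T) VV mul1mx.
have Hs : it_H r b *m it_s b = (it_J r b)^T *m it_U b *m it_Sigma b *m it_y b.
  rewrite /it_H /it_s -!mulmxA (mulmxA (it_J r b)) JV.
  by rewrite -!mulmxA (mulmxA (it_Z b)^T) ZZ mul1mx.
have VHs : (it_V b)^T *m (it_H r b *m it_s b)
    = it_Z b *m (it_Sigma b *m it_Sigma b *m it_y b).
  rewrite Hs !mulmxA JVt -!mulmxA (mulmxA (it_U b)^T) UU mul1mx.
  by rewrite !mulmxA.
have Vg : (it_V b)^T *m it_g r b = - (it_Z b *m (it_B prm b *m it_y b)).
  by rewrite By gE mulmxA JVt mulmxN opprK !mulmxA.
have key : it_P b *m (it_H r b *m it_s b)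
    + it_V b *m it_Z b *m (it_R prm b *m it_y b) = - (it_P b *m it_g r b).
  rewrite /it_P -!(mulmxA (it_V b)) VHs Vg /it_B mulmxDl !mulmxN opprK.
  by rewrite -!mulmxDr.
(* Once [key] expresses the damping term through [P g] and [P H s], only cancellations using
   [P s = s] remain. *)
have -> : it_V b *m it_Z b *m (it_R prm b *m it_y b)
    = - (it_P b *m it_g r b) - it_P b *m (it_H r b *m it_s b).
  by rewrite -key addrAC subrr add0r.
rewrite !mulmxBl mul1mx -!(mulmxA _ (it_P b) (it_s b)) Ps.
rewrite -(mulmxA (it_P b) (it_H r b)) !opprD !opprK.
by rewrite addrACA !subrK addrC.
Qed.

(** Each entry [max(sigma^2, delta)] of [D] is at most [sigma^2 + delta], so
    [|D y| <= |Sigma^2 y| + delta |y|]. Since [V Z] has orthonormal columns, [|y| = |s|]; since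
    [J V Z = U Sigma], [Sigma^2 y = Z^T V^T H s], whose norm is at most [|H| |s|]. *)
Lemma damping_norm_le b :
  hslm_iteration prm r b -> 0 < delta prm -> 0 <= it_mu b ->
  enorm (it_R prm b *m it_y b) <=
    it_mu b * ((delta prm + opnorm (it_H r b)) * enorm (it_s b)).
Proof.
move=> [[VV _ [JV UU ZZ _]] _] delta0 mu_ge0.
have ys : enorm (it_y b) = enorm (it_s b).
  by rewrite /it_s -mulmxA !enorm_isometry.
have SSy : it_Sigma b *m it_Sigma b *m it_y b =
    (it_Z b)^T *m ((it_V b)^T *m (it_H r b *m it_s b)).
  rewrite /it_H /it_s !mulmxA -trmx_mul -trmx_mul -!mulmxA !(mulmxA (it_J r b)).
  rewrite JV !trmx_mul !trmxK tr_diag_mx -!mulmxA.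
  by rewrite !(mulmxA (it_Z b)^T) ZZ !mul1mx !(mulmxA (it_U b)^T) UU !mul1mx.
have HsE : enorm (it_Sigma b *m it_Sigma b *m it_y b)
    <= opnorm (it_H r b) * enorm (it_s b).
  rewrite SSy; apply: le_trans (enorm_mulmx_le _ _).
  by apply: le_trans (enorm_tr_isometry _ ZZ) (enorm_tr_isometry _ VV).
rewrite /it_R -scalemxAl enormZ // ler_wpM2l //.
rewrite mulrDl addrC -[in delta prm * _]ys -[delta prm * _]enormZ ?(ltW delta0) //.
apply: le_trans (lerD HsE (lexx _)).
apply: le_trans (ler_enormD _ _).
apply: enorm_mono => i.
rewrite /it_D /it_Sigma mulmx_diag !mul_diag_mx !mxE -expr2.
rewrite -mulrDl !normrM ler_wpM2r // !ger0_norm ?le_max ?addr_ge0 ?sqr_ge0 ?(ltW delta0) //.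
by rewrite ge_max lerDl lerDr sqr_ge0 (ltW delta0).
Qed.

Lemma full_step_error_le b (A : 'M[R]_n) (e : 'cV[R]_n) (eps : R) :
  hslm_iteration prm r b -> it_g r b = (it_J r b)^T *m r (it_x b) ->
  0 < delta prm -> 0 <= it_mu b -> it_g r b != 0 ->
  opnorm (it_H r b *m it_P b - it_P b *m it_H r b *m it_P b) <=
    eps * opnorm (it_H r b) ->
  enorm (A *m (e + it_s b)) <=
    enorm (A *m e - it_g r b) + it_gamma r b * enorm (it_g r b)
    + (opnorm (A - it_H r b) + eps * opnorm (it_H r b)
       + it_mu b * (delta prm + opnorm (it_H r b))) * enorm (it_s b).
Proof.
move=> itb gE delta0 mu_ge0 g0 HPle.
have [[VV _ [_ _ ZZ _]] _] := itb.
have -> : A *m (e + it_s b) = (A *m e - it_g r b) + (A - it_H r b) *m it_s b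
    + (it_H r b *m it_s b + it_g r b).
  rewrite mulmxDr mulmxBl [it_H r b *m it_s b + _]addrC.
  by rewrite addrACA !subrK.
(* As [g] is nonzero, [gamma |g|] is exactly [|(I - P) g|]. *)
rewrite gauss_newton_step_residual // /it_gamma divfK ?gt_eqF ?enorm_gt0 //.
set u := A *m e - _; set v := (A - _) *m _; set w := (1%:M - _) *m _.
set z := (_ - _) *m it_s b; set a := it_V b *m _ *m _.
have va := enorm_mulmx_le (A - it_H r b) (it_s b).
have za : enorm z <= eps * opnorm (it_H r b) * enorm (it_s b).
  by apply: le_trans (enorm_mulmx_le _ _) _; rewrite ler_wpM2r ?enorm_ge0.
have aa : enorm a <= it_mu b *
    ((delta prm + opnorm (it_H r b)) * enorm (it_s b)).
  rewrite /a -mulmxA (enorm_isometry _ VV) (enorm_isometry _ ZZ).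
  exact: damping_norm_le.
have := ler_enormD (u + v) (w + z - a); have := ler_enormD u v.

have := ler_enormB (w + z) a; have := ler_enormD w z.
by rewrite -/v in va; lra.
Qed.

End Iteration.

(** * Derivatives of the objective and first-order expansions *)

Section Calculus.
Context {R : realType} {m n : nat}.
Implicit Types (r : 'cV[R]_n -> 'cV[R]_m) (f : 'cV[R]_n -> R).

Lemma differentiable_entry p q (M : 'cV[R]_n -> 'M[R]_(p, q)) x i j :
  differentiable M x -> differentiable (fun y => M y i j) x.
Proof.
move=> dM; apply: (@differentiable_comp _ _ _ _ M (fun N : 'M[R]_(p, q) => N i j)) => //.
exact: differentiable_coord.
Qed.

Lemma grad_objective r : (forall x, differentiable r x) ->
  grad (objective r) = fun x => (jac r x)^T *m r x.
Proof.
move=> dr; apply/funext => x; apply/matrixP => k j; rewrite ord1 {j} !mxE.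
have -> : objective r = 2^-1 *: (\sum_i (fun y => r y i 0) ^+ 2).
  apply/funext => y; rewrite /objective sqr_enorm_sum fctE fct_sumE.
  by congr (_ * _); apply: eq_bigr => i _; rewrite fctE.
have dri i : derivable (fun y => r y i 0) x (delta_mx k 0).
  exact/diff_derivable/differentiable_entry.
rewrite deriveZ ?derive_sum //=; last 2 first.
- by move=> i; apply: derivableX.
- by apply: derivable_sum => i; apply: derivableX.
rewrite scaler_sumr; apply: eq_bigr => i _.
rewrite deriveX // !mxE expr1 scalerA mulrA mulVf ?pnatr_eq0 // mul1r.
by rewrite mulrC.
Qed.

Lemma grad_objective_entry r k x : (forall x, differentiable r x) ->
  grad (objective r) x k 0 = \sum_i jac r x i k * r x i 0.
Proof.
by move=> dr; rewrite grad_objective // mxE; apply: eq_bigr => i _; rewrite mxE.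
Qed.

Lemma differentiable_grad_objective r a k : (forall x, differentiable r x) ->
  differentiable (jac r) a ->
  differentiable (fun x => grad (objective r) x k 0) a.
Proof.
move=> dr dJ.
have -> : (fun x => grad (objective r) x k 0) =
    \sum_i (fun x => jac r x i k) * (fun x => r x i 0).
  by apply/funext => x; rewrite grad_objective_entry // fct_sumE.
by apply: differentiable_sum => i; apply: differentiableM;
  exact: differentiable_entry.
Qed.

Lemma hess_objective r a : (forall x, differentiable r x) ->
  differentiable (jac r) a ->
  hess (objective r) a = (jac r a)^T *m jac r a + curvature r a.
Proof.
move=> dr dJ; apply/matrixP => k l; rewrite /hess /jac mxE.
have -> : (fun x => grad (objective r) x k 0) =
    \sum_i (fun x => jac r x i k) * (fun x => r x i 0).
  by apply/funext => x; rewrite grad_objective_entry // fct_sumE.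
have dri i : derivable (fun x => r x i 0) a (delta_mx l 0).
  exact/diff_derivable/differentiable_entry.
have dJi i : derivable (fun x => jac r x i k) a (delta_mx l 0).
  exact/diff_derivable/differentiable_entry.
rewrite derive_sum; last by move=> i; apply: derivableM.
rewrite !mxE summxE -big_split; apply: eq_bigr => i _ /=.
(* In the product rule for [J_ik r_i], differentiating [r_i] gives the [J^T J] entry and
   differentiating [J_ik] gives the curvature entry. *)
rewrite deriveM // !mxE; congr (_ + _ * _).
by congr derive; apply/funext => x; rewrite !mxE.
Qed.

Lemma diff_partials f a v : differentiable f a ->
  'd f a v = \sum_j 'D_(delta_mx j 0) f a * v j 0.
Proof.
move=> df; rewrite [in LHS](matrix_sum_delta v) linear_sum /=.
by apply: eq_bigr => j _; rewrite big_ord1 linearZ /= deriveE // mulrC.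
Qed.

(** The little-o definition of the differential, translated from increments [h] near 0 to points [x]
    near [a]. *)
Lemma near_diff_le f a (eta : R) : differentiable f a -> 0 < eta ->
  \forall x \near a, `|f x - f a - 'd f a (x - a)| <= eta * `|x - a|.
Proof.
move=> df eta0; have := diff_locally df => /eqaddoP/(_ _ eta0) dfa.
apply/nbhs0P; near=> h; rewrite (addrC a) addrK -addrA -opprD.
near: h; exact: dfa.
Unshelve. all: by end_near. Qed.

Lemma normr_le_enorm p (v : 'cV[R]_p) : `|v| <= enorm v.
Proof.
rewrite [leLHS]/Num.Def.normr /= mx_normrE; apply: bigmax_le; first exact: enorm_ge0.
by move=> -[i j] _; rewrite ord1 coord_le_enorm.
Qed.

Lemma near_jac_le (G : 'cV[R]_n -> 'cV[R]_m) a (eta : R) :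
  (forall i, differentiable (fun x => G x i 0) a) -> 0 < eta ->
  \forall x \near a,
    enorm (G x - G a - jac G a *m (x - a)) <= eta * enorm (x - a).
Proof.
move=> dG eta0.
(* Each of the [m] components gets tolerance [eta / (m + 1)]; the total is at most [eta], and the
   denominator is nonzero even for [m = 0]. *)
have eta1 : 0 < eta / m.+1%:R by rewrite divr_gt0.
have : \forall x \near a, forall i,
    `|G x i 0 - G a i 0 - 'd (fun x => G x i 0) a (x - a)|
    <= eta / m.+1%:R * `|x - a|.
  exact: (filter_forall _ (fun i => near_diff_le (dG i) eta1)).
apply: filterS => x Gx; apply: le_trans (enorm_le_sum _) _.
apply: (@le_trans _ _ (\sum_(i < m) eta / m.+1%:R * enorm (x - a))).
  apply: ler_sum => i _; rewrite !mxE.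
  have -> : \sum_j jac G a i j * (x - a) j 0 = 'd (fun x => G x i 0) a (x - a).
    by rewrite diff_partials //; apply: eq_bigr => j _; rewrite mxE.
  apply: le_trans (Gx i) _.
  by rewrite ler_wpM2l ?normr_le_enorm // ltW.
rewrite sumr_const card_ord -[leLHS]mulr_natl mulrA ler_wpM2r ?enorm_ge0 //.
by rewrite mulrCA ler_piMr ?(ltW eta0) // ler_pdivrMr // mul1r ler_nat.
Qed.

End Calculus.

(** * Limits along the sequence and the superlinear rate *)

Section Superlinear.
Context {R : realType}.

(** Column [j] is the image of the [j]-th basis vector, so its norm is at most 0. *)
Lemma opnorm_le0 m n (A : 'M[R]_(m, n)) : opnorm A <= 0 -> A = 0.
Proof.
move=> A0; apply/matrixP => i j; rewrite [RHS]mxE; apply/eqP.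
rewrite -normr_le0.
have := enorm_mulmx_le A (delta_mx j 0); rewrite -colE => Aj.
have := coord_le_enorm (col j A) i; rewrite mxE => /le_trans; apply.
by apply: le_trans Aj _; rewrite mulr_le0_ge0 ?enorm_ge0.
Qed.

Lemma posdef_enorm_le n (A : 'M[R]_n) : posdef A ->
  exists2 c : R, 0 < c & forall v : 'cV[R]_n, enorm v <= c * enorm (A *m v).
Proof.
move=> Apos; have Aunit : A \in unitmx.
  (* [row_free] concerns left kernels, hence the transpose: [v A^T = 0] means [A v^T = 0], and then
     the quadratic form vanishes at [v^T]. *)
  rewrite -unitmx_tr -row_free_unit; apply: inj_row_free => v.
  move/(congr1 trmx); rewrite trmx_mul trmxK trmx0 => Av0.
  apply: contraTeq isT => v0; have := Apos v^T; rewrite -mulmxA Av0 mulmx0 mxE.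
  by rewrite ltxx trmx_eq0 => /(_ v0).
(* The added 1 keeps the constant positive when [n = 0]. *)
exists (opnorm (invmx A) + 1) => [|v]; first by rewrite ltr_wpDl ?opnorm_ge0.
rewrite -{1}[v](mulKmx Aunit); apply: le_trans (enorm_mulmx_le _ _) _.
by rewrite ler_wpM2r ?enorm_ge0 // lerDl.
Qed.

Lemma cvg_sum (T : Type) (F : set_system T) {FF : Filter F} (I : finType)
    (f : I -> T -> R) (l : I -> R) :
  (forall i, f i x @[x --> F] --> l i) ->
  \sum_i f i x @[x --> F] --> \sum_i l i.
Proof.
move=> fl; apply: cvg_big => //; exact: add_continuous.
Qed.

Lemma cvg_entry_sum m n (M : nat -> 'M[R]_(m, n)) (A : 'M[R]_(m, n)) :
  (forall i j, M k i j @[k --> \oo] --> A i j) ->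
  \sum_i \sum_j `|M k i j| @[k --> \oo] --> \sum_i \sum_j `|A i j|.
Proof.
by move=> MA; apply: cvg_sum => i; apply: cvg_sum => j; apply: cvg_norm.
Qed.

Lemma cvg_opnormB m n (M : nat -> 'M[R]_(m, n)) (A : 'M[R]_(m, n)) :
  (forall i j, M k i j @[k --> \oo] --> A i j) ->
  opnorm (A - M k) @[k --> \oo] --> (0 : R).
Proof.
move=> MA.
have h : \sum_i \sum_j `|(A - M k) i j| @[k --> \oo] --> (0 : R).
  have sum0 : \sum_i \sum_j `|(0 : 'M[R]_(m, n)) i j| = 0.
    by rewrite big1 // => i _; rewrite big1 // => j _; rewrite mxE normr0.
  rewrite -[X in _ --> X]sum0.
  apply: (@cvg_entry_sum _ _ (fun k => A - M k)) => i j; rewrite [X in _ --> X]mxE -(subrr (A i j)).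
  under eq_cvg do rewrite !mxE.
  by apply: cvgB => //; exact: cvg_cst.
apply: squeeze_cvgr (cvg_cst 0) h.
by near=> k; rewrite opnorm_ge0 opnorm_le_sum.
Unshelve. all: by end_near. Qed.

Lemma hslm_mu_ge0 m n (prm : hslm_params R) (r : 'cV[R]_n -> 'cV[R]_m) it k :
  admissible prm -> hslm_sequence prm r it -> 0 <= it_mu (it k).
Proof.
move=> [[mu0 _ _] [_ _ _ up down]] [it0 itS]; elim: k => [|k IHk].
  by rewrite it0 ltW.
have [_ _ _ ->] := itS k; rewrite /it_mu_next.
have up0 := le_trans ler01 (ltW up); have down0 := le_trans ler01 (ltW down).
by do 2?case: ifP => _ //; rewrite ?divr_ge0 ?mulr_ge0.
Qed.

(** The rate is stated for every [eta > 0] instead of as a limit of quotients: one [eta < 1] gives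
    linear convergence, and all of them together give the superlinear limit. *)
Lemma hslm_superlinear (m n : nat) (prm : hslm_params R)
    (r : 'cV[R]_n -> 'cV[R]_m) (it : nat -> hslm_iter R m n)
    (xstar : 'cV[R]_n) (eps : nat -> R) :
  admissible prm -> cont_differentiable r -> differentiable (jac r) xstar ->
  hslm_sequence prm r it ->
  grad (objective r) xstar = 0 -> posdef (hess (objective r) xstar) ->
  curvature r xstar = 0 ->
  it_x (it k) @[k --> \oo] --> xstar ->
  it_gamma r (it k) @[k --> \oo] --> (0 : R) ->
  it_mu (it k) @[k --> \oo] --> (0 : R) ->
  (forall k, 0 <= eps k) -> eps k @[k --> \oo] --> (0 : R) ->
  (forall k,
    opnorm (it_H r (it k) *m it_P (it k)
            - it_P (it k) *m it_H r (it k) *m it_P (it k)) <=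
      eps k * opnorm (it_H r (it k))) ->
  (\forall k \near \oo, it_t (it k) = 1) ->
  forall eta : R, 0 < eta -> \forall k \near \oo,
    enorm (it_x (it k.+1) - xstar) <= eta * enorm (it_x (it k) - xstar).
Proof.
move=> adm [dr cJ] dJ its g0 Apos S0 xcvg gammacvg mucvg eps0 epscvg HP tcvg.
set A := hess (objective r) xstar in Apos.
have AE : A = (jac r xstar)^T *m jac r xstar.
  by rewrite /A hess_objective // S0 addr0.
have [c c0 cA] := posdef_enorm_le Apos.
have Hcvg i j : it_H r (it k) i j @[k --> \oo] --> A i j.
  have Jcvg l q : it_J r (it k) l q @[k --> \oo] --> jac r xstar l q.
    have Jcvg : jac r (it_x (it k)) @[k --> \oo] --> jac r xstar.
      by apply: continuous_cvg => //; exact: cJ.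
    apply: (@continuous_cvg _ _ _ _ _ (fun k => it_J r (it k))
      (fun M : 'M[R]_(m, n) => M l q)) => //; exact: coord_continuous.
  have gramE (J : 'M[R]_(m, n)) : (J^T *m J) i j = \sum_l J l i * J l j.
    by rewrite mxE; apply: eq_bigr => l _; rewrite mxE.
  rewrite AE gramE; under eq_cvg do rewrite gramE.
  by apply: cvg_sum => l; exact: cvgM.
(* [h k] is a convergent majorant of [opnorm] of [H_k]. *)
set h := fun k => \sum_i \sum_j `|it_H r (it k) i j|.
have hcvg : h k @[k --> \oo] --> \sum_i \sum_j `|A i j| by exact: cvg_entry_sum.
(* The coefficient of [|s|] in [full_step_error_le], with [h k] in place of the norm of [H_k]. *)
set a := fun k => opnorm (A - it_H r (it k)) + eps k * h k
  + it_mu (it k) * (delta prm + h k).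
have acvg : a k @[k --> \oo] --> (0 : R).
  set hA := \sum_i _ in hcvg.
  rewrite -[X in _ --> X](_ : 0 + 0 * hA + 0 * (delta prm + hA) = 0);
    last by rewrite !mul0r !addr0.
  apply: cvgD; last by apply: cvgM => //; apply: cvgD => //; exact: cvg_cst.
  by apply: cvgD; [exact: cvg_opnormB | exact: cvgM].
move=> eta eta0.
(* [K] collects the multiples of [tau |e|]: 1 from [A e - g], [|A| + 1] from [gamma |g|], and 1 from
   [|s| <= |e + s| + |e|]. *)
set K := 3 + opnorm A.
have K0 : 0 < K by rewrite ltr_wpDr ?opnorm_ge0.
(* The bound 1 gives [|g| <= (|A| + 1) |e|], the second allows [|e + s|] to be absorbed on the left,
   and the third yields the factor [eta]. *)
set tau := Num.min 1 (Num.min (2 * c)^-1 (eta / (2 * c * K))).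
have tau0 : 0 < tau by rewrite !lt_min ltr01 invr_gt0 divr_gt0 ?mulr_gt0.
have tau1 : tau <= 1 by rewrite ge_min lexx.
have tauc : c * tau <= 2^-1.
  by rewrite mulrC -ler_pdivlMr // -invfM !ge_min lexx orbT.
have taueta : 2 * c * K * tau <= eta.
  by rewrite mulrC -ler_pdivlMr ?mulr_gt0 // !ge_min lexx !orbT.
have glin : \forall k \near \oo, enorm (A *m (it_x (it k) - xstar) - it_g r (it k))
    <= tau * enorm (it_x (it k) - xstar).
  have dg i : differentiable (fun x => grad (objective r) x i 0) xstar.
    exact: differentiable_grad_objective.
  have Q := xcvg _ (near_jac_le dg tau0); rewrite /nbhs /= in Q.
  apply: filterS Q => k /=.
  (* The gradient vanishes at [xstar] and its Jacobian there is [A], so the expansion compares [g]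
     with [A e]. *)
  by rewrite g0 subr0 -enormN opprB.
have [_ delta0 _] := adm.1.
near=> k.
have [gk itk xS _] := its.2 k.
have tk : it_t (it k) = 1 by near: k.
have gam : it_gamma r (it k) <= tau.
  apply: le_trans (ler_norm _) _; near: k.
  exact: cvgr0_norm_le gammacvg _ tau0.
have ak : a k <= tau.
  apply: le_trans (ler_norm _) _; near: k.
  exact: cvgr0_norm_le acvg _ tau0.
have gl : enorm (A *m (it_x (it k) - xstar) - it_g r (it k))
    <= tau * enorm (it_x (it k) - xstar) by near: k.
set e := it_x (it k) - xstar in gl *; set s := it_s (it k).
have -> : it_x (it k.+1) - xstar = e + s.
  by rewrite xS /it_next tk scale1r addrAC.
have gE : it_g r (it k) = (it_J r (it k))^T *m r (it_x (it k)).
  by rewrite /it_g grad_objective.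
have mu0 := hslm_mu_ge0 k adm its.
have step := full_step_error_le A e itk gE delta0 mu0 gk (HP k).
have s_le : enorm s <= enorm (e + s) + enorm e.
  by rewrite -{1}[s](addKr e) addrC ler_enormB.
have g_le : enorm (it_g r (it k)) <= (opnorm A + tau) * enorm e.
  rewrite -[it_g r (it k)](subKr (A *m e)) mulrDl.
  by apply: le_trans (ler_enormB _ _) _; rewrite lerD ?enorm_mulmx_le.
have a_le : opnorm (A - it_H r (it k)) + eps k * opnorm (it_H r (it k))
       + it_mu (it k) * (delta prm + opnorm (it_H r (it k))) <= a k.
  by rewrite /a !lerD // ler_wpM2l ?lerD ?opnorm_le_sum.
have e0 := enorm_ge0 e; have es0 := enorm_ge0 (e + s); have s0 := enorm_ge0 s.
have gamg : it_gamma r (it k) * enorm (it_g r (it k))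
    <= tau * ((opnorm A + 1) * enorm e).
  apply: ler_pM => //; rewrite ?enorm_ge0 ?divr_ge0 ?enorm_ge0 //.
  by apply: le_trans g_le _; rewrite ler_wpM2r // lerD2l.
have a_s := ler_wpM2r s0 (le_trans a_le ak).
have t_s := ler_wpM2l (ltW tau0) s_le.
have : enorm (A *m (e + s)) <= tau * (K * enorm e + enorm (e + s)).
  apply: le_trans step _; rewrite /K; lra.
move=> /(ler_wpM2l (ltW c0)) /(le_trans (cA (e + s))) main.
(* Here [|e + s| <= c tau K |e| + c tau |e + s| <= (eta / 2) |e| + (1 / 2) |e + s|]. *)
have := ler_wpM2r es0 tauc; have := ler_wpM2r e0 taueta.
lra.
Unshelve. all: by end_near. Qed.

End Superlinear.

Theorem theorem2 (R : realType) (m n : nat) (prm : hslm_params R)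
    (r : 'cV[R]_n -> 'cV[R]_m) (it : nat -> hslm_iter R m n)
    (xstar : 'cV[R]_n) (eps : nat -> R) :
  admissible prm ->
  cont_differentiable r ->
  twice_differentiable_near r xstar ->
  hslm_sequence prm r it ->
  (* (1) *)
  (exists mB MB : R, 0 < mB /\
    forall k : nat,
      mB <= lambda_min (it_B prm (it k)) <= lambda_max (it_B prm (it k)) /\
      lambda_max (it_B prm (it k)) <= MB) ->
  (* (2) *)
  strict_local_min (objective r) xstar ->
  grad (objective r) xstar = 0 ->
  posdef (hess (objective r) xstar) ->
  (exists (U : set 'cV[R]_n) (L2 : R), nbhs xstar U /\ 0 < L2 /\
    forall x y : 'cV[R]_n, U x -> U y ->
      opnorm (hess (objective r) x - hess (objective r) y) <=
        L2 * enorm (x - y)) ->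
  (* (3) *)
  it_x (it k) @[k --> \oo] --> xstar ->
  it_gamma r (it k) @[k --> \oo] --> (0 : R) ->
  it_mu (it k) @[k --> \oo] --> (0 : R) ->
  (forall k : nat, 0 <= eps k) ->
  eps k @[k --> \oo] --> (0 : R) ->
  (forall k : nat,
    opnorm (it_H r (it k) *m it_P (it k)
            - it_P (it k) *m it_H r (it k) *m it_P (it k)) <=
      eps k * opnorm (it_H r (it k))) ->
  (* (4) *)
  (exists c : R, 0 < c /\
    \forall x \near xstar, opnorm (curvature r x) <= c * enorm (x - xstar)) ->
  (* (5) *)
  (\forall k \near \oo, it_t (it k) = 1) ->
  exists C : R, 0 < C /\
    let e := fun k : nat => it_x (it k) - xstar in
    let theta := fun k : nat =>
      C * (it_gamma r (it k) + eps k + opnorm (it_R prm (it k))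
           + opnorm (it_S r (it k))) in
    ((exists thetabar : R, thetabar < 1 /\
        \forall k \near \oo, theta k <= thetabar) ->
      exists q : R, q < 1 /\
        \forall k \near \oo, enorm (e k.+1) <= q * enorm (e k)) /\
    (theta k @[k --> \oo] --> (0 : R) ->
      enorm (e k.+1) / enorm (e k) @[k --> \oo] --> (0 : R)).
Proof.
move=> adm cdr tdr its _ _ g0 Apos _ xcvg gcvg mucvg eps0 epscvg HP [c [_ Sle]] tcvg.
have dJ : differentiable (jac r) xstar by have [] := nbhs_singleton tdr.
have S0 : curvature r xstar = 0.
  (* Assumption (4) taken at [x = xstar] itself, where the right-hand side is 0. *)
  apply: opnorm_le0; have := nbhs_singleton Sle.
  by rewrite subrr enorm0 mulr0.
have sup := hslm_superlinear adm cdr dJ its g0 Apos S0 xcvg gcvg mucvg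
  eps0 epscvg HP tcvg.
(* The constant [C] does not occur in [sup], so 1 is taken; [q = 1/2] is one instance of [eta]. *)
exists 1; split=> // e theta; split=> _.
  exists 2^-1; split; first by rewrite invf_lt1 // ltr1n.
  by apply: sup; rewrite invr_gt0.
apply/cvgr0Pnorm_le => eta eta0; near=> k.
rewrite ger0_norm ?divr_ge0 ?enorm_ge0 // ler_pdivrMr; last first.
  (* The quotient has a nonzero denominator: [x_k = xstar] would force [g_k = 0]. *)
  apply: enorm_gt0; rewrite subr_eq0; have [gk _ _ _] := its.2 k.
  by apply: contraNneq gk => xk; rewrite /it_g xk g0.
near: k; exact: sup.
Unshelve. all: by end_near. Qed.
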